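(* Let $\lambda>0$ be given and let $f:(0,\infty)\to\mathbb{R}$ be a function. The following properties are equivalent. (i) There is an absolutely monotonic function $\varphi:[0,\infty)\to\mathbb{R}$ such that $$f(x)=\int_0^{\infty}e^{-xt}t^{\lambda-1}\varphi(t)\,dt\quad\text{for all } x>0$$ (in particular the integral converges for every $x>0$). (ii) The function $x\mapsto(-1)^k(x^{k+\lambda-1}f(x))^{(k)}$ is completely monotonic on $(0,\infty)$ for all integers $k\geq 0$. (iii) The function $x\mapsto(-1)^k(x^{k+\lambda-1}f(x))^{(k)}$ is non-negative on $(0,\infty)$ for all integers $k\geq 0$.
   Context: A function $\varphi:[0,\infty)\to\mathbb{R}$ is absolutely monotonic if it is infinitely often differentiable on $[0,\infty)$ and $\varphi^{(k)}(x)\geq 0$ for all $k\geq 0$ and all $x\geq 0$. A function $g:(0,\infty)\to\mathbb{R}$ is completely monotonic if it is infinitely often differentiable on $(0,\infty)$ and $(-1)^ng^{(n)}(x)\geq 0$ for all $n\geq 0$ and all $x>0$. In (ii) and (iii) it is understood as part of the condition that the derivatives occurring there exist. *)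

(* Defs.v *)
From Stdlib Require Import Reals.
From Coquelicot Require Import Coquelicot.
Open Scope R_scope.

(* Functions on [0,oo) or (0,oo) are represented by total functions R -> R; every
   notion below only depends on their values on the relevant half-line. *)

(* [d k] is the k-th derivative of [phi] relative to the set [D], so on [0,oo) the
   derivatives at the endpoint 0 are one-sided. They are determined on [D] as soon
   as [D] has no isolated point. *)
Definition derivatives_in (D : R -> Prop) (phi : R -> R) (d : nat -> R -> R) : Prop :=
  (forall x, D x -> d 0%nat x = phi x) /\
  (forall k x, D x -> D_in (d k) (d (S k)) D x).

Definition absolutely_monotonic (phi : R -> R) : Prop :=
  exists d : nat -> R -> R,
    derivatives_in (fun x => 0 <= x) phi d /\
    (forall k x, 0 <= x -> 0 <= d k x).

(* All orders j <= n are required on the whole half-line because [ex_derive_n g n x]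
   alone only says that the total function [Derive_n g (n - 1)] is differentiable
   at [x]. *)
Definition n_times_differentiable_pos (n : nat) (g : R -> R) : Prop :=
  forall j x, (j <= n)%nat -> 0 < x -> ex_derive_n g j x.

Definition completely_monotonic (g : R -> R) : Prop :=
  (forall n, n_times_differentiable_pos n g) /\
  (forall n x, 0 < x -> 0 <= (-1) ^ n * Derive_n g n x).

Definition weighted (lambda : R) (f : R -> R) (k : nat) (x : R) : R :=
  Rpower x (INR k + lambda - 1) * f x.

Definition signed_derivative (lambda : R) (f : R -> R) (k : nat) (x : R) : R :=
  (-1) ^ k * Derive_n (weighted lambda f k) k x.

(* Main.v *)
Require Import Defs.
From Stdlib Require Import Reals Factorial Lra Lia.
From Coquelicot Require Import Coquelicot.
Open Scope R_scope.

(** Put [h(y) = y^(-lambda) f(1/y)], called [inverted lambda f] below.  The classical identity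
    [(-1)^k (x^(k-1) h(1/x))^(k) = x^(-k-1) h^(k)(1/x)] shows that (iii) says that
    every [h^(k)] is non-negative on [(0,oo)], i.e. (Bernstein) that
    [h(y) = sum b_n y^n] for [y > 0], with all [b_n >= 0].  Differentiating
    [x^(-k-1) h^(k)(1/x)] produces only terms of the same shape with alternating
    signs, whence complete monotonicity.  Finally, by monotone convergence,
    [phi(t) = sum a_n t^n] with [a_n >= 0] has transform
    [f(x) = sum a_n Gamma(n + lambda) x^(-n-lambda)], so (i) and the expansion of [h]
    are the same thing under [b_n = a_n Gamma(n + lambda)]. *)

(** * Derivatives on the positive half-line and the inversion [x -> 1/x] *)

(** Bernstein's theorem is applied to [h] and also to [phi], and each time only the open half-line
    is used. The Taylor coefficients at 0 must therefore be produced as limits, with a remainder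
    estimate that survives as the centre of expansion approaches 0. The expansions hold at every
    point of [(0,oo)], so all power series involved are entire. Convergence needs an argument only
    when [b_n] is divided by [Gamma (INR n + lambda)]; a lower bound for Gamma that is uniform in
    its argument settles it. For [lambda < 1] the integral is improper at both ends. The integrands
    are non-negative and continuous on [(0,oo)], so the integral is treated as the supremum of the
    integrals over compact subintervals. Existence, scaling and interchange with the sum then become
    statements about upper bounds. *)

Lemma locally_pos (x : R) : 0 < x -> locally x (fun y => 0 < y).
Proof. exact (open_gt 0 x). Qed.

Lemma is_derive_eq (f : R -> R) (x l l' : R) :
  is_derive f x l -> l = l' -> is_derive f x l'.
Proof. now intros H <-. Qed.

Lemma is_derive_Rpower (a x : R) :
  0 < x -> is_derive (fun t => Rpower t a) x (a * Rpower x (a - 1)).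
Proof. intros Hx. apply is_derive_Reals. now apply derivable_pt_lim_power. Qed.

Lemma Derive_n_ext_pos (f g : R -> R) (n : nat) :
  (forall y, 0 < y -> f y = g y) ->
  forall x, 0 < x -> Derive_n f n x = Derive_n g n x.
Proof.
  intros Hfg x Hx. apply Derive_n_ext_loc.
  exact (filter_imp _ _ Hfg (locally_pos x Hx)).
Qed.

(** [Derive_n] recurses on the outermost derivative; this removes the innermost one, so that an
    induction can pass from a function to its derivative. *)
Lemma Derive_n_of_derive (g g' : R -> R) (n : nat) :
  (forall x, 0 < x -> is_derive g x (g' x)) ->
  forall x, 0 < x -> Derive_n g (S n) x = Derive_n g' n x.
Proof.
  intros Hg. induction n as [|n IH]; intros x Hx.
  - now apply is_derive_unique, Hg.
  - change (Derive (Derive_n g (S n)) x = Derive (Derive_n g' n) x).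
    apply Derive_ext_loc. exact (filter_imp _ _ IH (locally_pos x Hx)).
Qed.

Lemma differentiable_pos_ext (n : nat) (f g : R -> R) :
  (forall y, 0 < y -> f y = g y) ->
  n_times_differentiable_pos n f -> n_times_differentiable_pos n g.
Proof.
  intros Hfg Hf j x Hj Hx. apply ex_derive_n_ext_loc with f.
  - exact (filter_imp _ _ Hfg (locally_pos x Hx)).
  - now apply Hf.
Qed.

(** With [differentiable_pos_S_inv] this reduces the closure properties below to computing first
    derivatives. *)
Lemma differentiable_pos_S (n : nat) (g g' : R -> R) :
  (forall x, 0 < x -> is_derive g x (g' x)) ->
  n_times_differentiable_pos n g' -> n_times_differentiable_pos (S n) g.
Proof.
  intros Hg Hn [|[|j]] x Hj Hx.
  - exact I.
  - exists (g' x). now apply Hg.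
  - change (ex_derive (Derive_n g (S j)) x).
    apply ex_derive_ext_loc with (Derive_n g' j).
    + apply filter_imp with (2 := locally_pos x Hx).
      intros y Hy. symmetry. now apply Derive_n_of_derive.
    + apply (Hn (S j) x); [lia | assumption].
Qed.

Lemma differentiable_pos_S_inv (n : nat) (g : R -> R) :
  n_times_differentiable_pos (S n) g ->
  (forall x, 0 < x -> is_derive g x (Derive g x)) /\
  n_times_differentiable_pos n (Derive g).
Proof.
  intros Hg. assert (Hd : forall x, 0 < x -> is_derive g x (Derive g x)).
  { intros x Hx. apply Derive_correct. apply (Hg 1%nat x); [lia | assumption]. }
  split; [exact Hd|]. intros [|j] x Hj Hx; [exact I|].
  change (ex_derive (Derive_n (Derive g) j) x).
  apply ex_derive_ext_loc with (Derive_n g (S j)).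
  - apply filter_imp with (2 := locally_pos x Hx).
    intros y Hy. now apply Derive_n_of_derive.
  - apply (Hg (S (S j)) x); [lia | assumption].
Qed.

Lemma differentiable_pos_le (n m : nat) (g : R -> R) :
  (m <= n)%nat -> n_times_differentiable_pos n g -> n_times_differentiable_pos m g.
Proof. intros Hmn Hg j x Hj Hx. apply Hg; [lia | assumption]. Qed.

Lemma differentiable_pos_plus (n : nat) : forall f g : R -> R,
  n_times_differentiable_pos n f -> n_times_differentiable_pos n g ->
  n_times_differentiable_pos n (fun x => f x + g x).
Proof.
  induction n as [|n IH]; intros f g Hf Hg.
  - intros [|j] x Hj Hx; [exact I | lia].
  - apply differentiable_pos_S_inv in Hf as [Hf Hf'].
    apply differentiable_pos_S_inv in Hg as [Hg Hg'].
    apply differentiable_pos_S with (2 := IH _ _ Hf' Hg').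
    intros x Hx. apply (is_derive_plus f g x); auto.
Qed.

Lemma differentiable_pos_mult (n : nat) : forall f g : R -> R,
  n_times_differentiable_pos n f -> n_times_differentiable_pos n g ->
  n_times_differentiable_pos n (fun x => f x * g x).
Proof.
  induction n as [|n IH]; intros f g Hf Hg.
  - intros [|j] x Hj Hx; [exact I | lia].
  - pose proof (differentiable_pos_le _ n _ (Nat.le_succ_diag_r n) Hf) as Hf0.
    pose proof (differentiable_pos_le _ n _ (Nat.le_succ_diag_r n) Hg) as Hg0.
    apply differentiable_pos_S_inv in Hf as [Hf Hf'].
    apply differentiable_pos_S_inv in Hg as [Hg Hg'].
    apply differentiable_pos_S with
      (2 := differentiable_pos_plus n _ _ (IH _ _ Hf' Hg0) (IH _ _ Hf0 Hg')).
    intros x Hx. apply (is_derive_mult f g x); auto. exact Rmult_comm.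
Qed.

Lemma differentiable_pos_const (n : nat) : forall c : R,
  n_times_differentiable_pos n (fun _ => c).
Proof.
  induction n as [|n IH]; intros c.
  - intros [|j] x Hj Hx; [exact I | lia].
  - apply differentiable_pos_S with (2 := IH 0).
    intros x _. apply (is_derive_const c x).
Qed.

Lemma differentiable_pos_Rpower (n : nat) : forall a : R,
  n_times_differentiable_pos n (fun x => Rpower x a).
Proof.
  induction n as [|n IH]; intros a.
  - intros [|j] x Hj Hx; [exact I | lia].
  - apply differentiable_pos_S with
      (2 := differentiable_pos_mult n _ _ (differentiable_pos_const n a) (IH (a - 1))).
    intros x Hx. now apply is_derive_Rpower.
Qed.

Lemma is_derive_comp_inv (g : R -> R) (x l : R) :
  0 < x -> is_derive g (/ x) l ->
  is_derive (fun t => g (/ t)) x (- l * Rpower x (- (2))).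
Proof.
  intros Hx Hg.
  assert (Hp : Rpower x (- (2)) = / x ^ 2).
  { rewrite Rpower_Ropp, <- (Rpower_pow 2 x Hx). now replace (INR 2) with 2 by (simpl; ring). }
  refine (is_derive_eq _ _ _ _ (is_derive_comp g Rinv x l (- (1 / x ^ 2)) Hg _) _).
  - refine (is_derive_eq _ _ _ _ (is_derive_inv (fun t => t) x 1 (is_derive_id x) _) _).
    + lra.
    + field. lra.
  - rewrite Hp. unfold scal; simpl; unfold mult; simpl. field. lra.
Qed.

Lemma differentiable_pos_comp_inv (n : nat) : forall g : R -> R,
  n_times_differentiable_pos n g -> n_times_differentiable_pos n (fun x => g (/ x)).
Proof.
  induction n as [|n IH]; intros g Hg.
  - intros [|j] x Hj Hx; [exact I | lia].
  - apply differentiable_pos_S_inv in Hg as [Hg Hg'].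
    pose proof (differentiable_pos_mult n _ _
      (differentiable_pos_mult n _ _ (differentiable_pos_const n (-1)) (IH _ Hg'))
      (differentiable_pos_Rpower n (- (2)))) as H.
    apply differentiable_pos_S with (2 := H).
    intros x Hx.
    refine (is_derive_eq _ _ _ _ (is_derive_comp_inv g x _ Hx (Hg _ _)) _).
    + now apply Rinv_0_lt_compat.
    + ring.
Qed.

(** * Chains of derivatives and the inversion identity *)

Definition derivative_chain (H : nat -> R -> R) : Prop :=
  forall k x, 0 < x -> is_derive (H k) x (H (S k) x).

Lemma Derive_n_chain (H : nat -> R -> R) : derivative_chain H ->
  forall n j x, 0 < x -> Derive_n (H j) n x = H (j + n)%nat x.
Proof.
  intros HH. induction n as [|n IH]; intros j x Hx.
  - now rewrite Nat.add_0_r.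
  - rewrite (Derive_n_of_derive _ (H (S j)) n) by auto.
    rewrite IH by assumption. f_equal. lia.
Qed.

Lemma differentiable_pos_chain (H : nat -> R -> R) : derivative_chain H ->
  forall n j, n_times_differentiable_pos n (H j).
Proof.
  intros HH. induction n as [|n IH]; intros j.
  - intros [|i] x Hi Hx; [exact I | lia].
  - apply differentiable_pos_S with (H (S j)); [exact (HH j) | apply IH].
Qed.

Lemma Rpower_comp_inv_derive (H : nat -> R -> R) (a : R) (j : nat) (x : R) :
  derivative_chain H -> 0 < x ->
  is_derive (fun t => Rpower t a * H j (/ t)) x
    (a * (Rpower x (a - 1) * H j (/ x)) - Rpower x (a - 2) * H (S j) (/ x)).
Proof.
  intros HH Hx.
  refine (is_derive_eq _ _ _ _ (is_derive_mult (fun t => Rpower t a)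
     (fun t => H j (/ t)) x _ _ (is_derive_Rpower a x Hx)
     (is_derive_comp_inv (H j) x _ Hx (HH j _ (Rinv_0_lt_compat _ Hx))) Rmult_comm) _).
  unfold plus, mult; simpl. replace (a - 2) with (a + - (2)) by ring.
  rewrite Rpower_plus. ring.
Qed.

(* Induct on [k] for all chains at once: [(x^k h(1/x))' = x^(k-1) g(1/x)] with
   [g(y) = k h(y) - y h'(y)], and [g^(k)(y) = - y h^(k+1)(y)]. *)
Lemma weighted_inversion_derivatives (k : nat) : forall H : nat -> R -> R,
  derivative_chain H ->
  n_times_differentiable_pos k (fun x => Rpower x (INR k - 1) * H 0%nat (/ x)) /\
  forall x, 0 < x ->
    (-1) ^ k * Derive_n (fun x => Rpower x (INR k - 1) * H 0%nat (/ x)) k x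
    = Rpower x (- (INR k + 1)) * H k (/ x).
Proof.
  induction k as [|k IH]; intros H HH.
  - split.
    + intros [|j] x Hj Hx; [exact I | lia].
    + intros x Hx. simpl. replace (- (0 + 1)) with (0 - 1) by ring. ring.
  (* [G j] is the j-th derivative of [g]: differentiating [y * H (S j) y] releases one more
     [H (S j) y], which lowers the coefficient [INR k - INR j] by one. *)
  - set (G := fun (j : nat) y => (INR k - INR j) * H j y - y * H (S j) y).
    assert (HG : derivative_chain G).
    { intros j y Hy. unfold G.
      refine (is_derive_eq _ _ _ _ (is_derive_minus
        (fun y => (INR k - INR j) * H j y) (fun y => y * H (S j) y) y _ _
        (is_derive_scal (H j) y _ _ (HH j y Hy))
        (is_derive_mult (fun y => y) (H (S j)) y _ _ (is_derive_id y)
           (HH (S j) y Hy) Rmult_comm)) _).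
      rewrite S_INR. unfold minus, plus, opp, mult, one; simpl. ring. }
    destruct (IH G HG) as [Hdiff Hval].
    assert (HD : forall x, 0 < x ->
      is_derive (fun x => Rpower x (INR (S k) - 1) * H 0%nat (/ x)) x
        (Rpower x (INR k - 1) * G 0%nat (/ x))).
    { intros x Hx.
      refine (is_derive_eq _ _ _ _ (Rpower_comp_inv_derive H _ 0 x HH Hx) _).
      unfold G. rewrite S_INR. replace (INR k + 1 - 1) with (INR k) by ring.
      replace (Rpower x (INR k - 2)) with (Rpower x (INR k - 1) * / x).
      2: { rewrite <- (Rpower_1 x) at 2 by assumption.
           rewrite <- Rpower_Ropp, <- Rpower_plus. f_equal. ring. }
      simpl INR. ring. }
    split.
    + now apply differentiable_pos_S with (2 := Hdiff).
    + intros x Hx.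
      refine (eq_trans (f_equal _ (Derive_n_of_derive _ _ k HD x Hx)) _).
      simpl pow. rewrite Rmult_assoc, (Hval x Hx). unfold G.
      rewrite S_INR. replace (- (INR k + 1 + 1)) with (- (INR k + 1) + - (1)) by ring.
      rewrite Rpower_plus, (Rpower_Ropp x 1), Rpower_1 by assumption. ring.
Qed.

(** This encodes [(-1)^j g^(j) >= 0] for [j <= n]. Moving the sign into [g'] makes every level the
    same non-negativity claim, so that plain induction applies. *)
Fixpoint alternating (n : nat) (g : R -> R) : Prop :=
  (forall x, 0 < x -> 0 <= g x) /\
  match n with
  | O => True
  | S n => exists g', (forall x, 0 < x -> is_derive g x (- g' x)) /\ alternating n g'
  end.

Lemma alternating_linear (n : nat) : forall (a b : R) (f g : R -> R),
  0 <= a -> 0 <= b -> alternating n f -> alternating n g ->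
  alternating n (fun x => a * f x + b * g x).
Proof.
  induction n as [|n IH]; intros a b f g Ha Hb [Hf Hf'] [Hg Hg'].
  - split; [|exact I]. intros x Hx. specialize (Hf x Hx). specialize (Hg x Hx). nra.
  - split.
    + intros x Hx. specialize (Hf x Hx). specialize (Hg x Hx). nra.
    + destruct Hf' as [f' [Hf' Cf]]. destruct Hg' as [g' [Hg' Cg]].
      exists (fun x => a * f' x + b * g' x). split; [|now apply IH].
      intros x Hx.
      refine (is_derive_eq _ _ _ _ (is_derive_plus (fun x => a * f x) (fun x => b * g x) x _ _
        (is_derive_scal f x a _ (Hf' x Hx)) (is_derive_scal g x b _ (Hg' x Hx))) _).
      unfold plus; simpl. ring.
Qed.

Lemma alternating_spec (n : nat) : forall g : R -> R, alternating n g ->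
  n_times_differentiable_pos n g /\ forall x, 0 < x -> 0 <= (-1) ^ n * Derive_n g n x.
Proof.
  induction n as [|n IH]; intros g [Hg Hg'].
  - split.
    + intros [|j] x Hj Hx; [exact I | lia].
    + intros x Hx. simpl. rewrite Rmult_1_l. now apply Hg.
  - destruct Hg' as [g' [Hd Hg']]. destruct (IH _ Hg') as [Hdiff Hpos]. split.
    + apply differentiable_pos_S with (fun x => (-1) * g' x).
      * intros x Hx. refine (is_derive_eq _ _ _ _ (Hd x Hx) _). ring.
      * apply differentiable_pos_mult; [apply differentiable_pos_const | assumption].
    + intros x Hx. rewrite (Derive_n_of_derive g (fun x => - g' x) n Hd x Hx).
      rewrite Derive_n_opp. simpl. specialize (Hpos x Hx). lra.
Qed.

(** Both [a] and [j] vary in the induction: minus the derivative combines the functions for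
    [(a + 1, j)] and [(a + 2, S j)] with coefficients [a] and 1, and [0 <= a] keeps the first one
    non-negative. *)
Lemma alternating_inversion (H : nat -> R -> R) :
  derivative_chain H -> (forall k x, 0 < x -> 0 <= H k x) ->
  forall n a j, 0 <= a -> alternating n (fun x => Rpower x (- a) * H j (/ x)).
Proof.
  intros HH Hpos.
  assert (Hnn : forall a j x, 0 < x -> 0 <= Rpower x (- a) * H j (/ x)).
  { intros a j x Hx. apply Rmult_le_pos.
    - apply Rlt_le, exp_pos.
    - now apply Hpos, Rinv_0_lt_compat. }
  induction n as [|n IH]; intros a j Ha; (split; [intros x Hx; now apply Hnn|]).
  - exact I.
  - eexists. split.
    2: { apply (alternating_linear n a 1 _ _ Ha Rle_0_1
                 (IH (a + 1) j ltac:(lra)) (IH (a + 2) (S j) ltac:(lra))). }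
    intros x Hx.
    refine (is_derive_eq _ _ _ _ (Rpower_comp_inv_derive H (- a) j x HH Hx) _).
    replace (- (a + 1)) with (- a - 1) by ring.
    replace (- (a + 2)) with (- a - 2) by ring. ring.
Qed.

Lemma completely_monotonic_ext (f g : R -> R) :
  (forall x, 0 < x -> f x = g x) -> completely_monotonic f -> completely_monotonic g.
Proof.
  intros Hfg [Hd Hs]. split.
  - intros n. now apply differentiable_pos_ext with f.
  - intros n x Hx. rewrite <- (Derive_n_ext_pos f g) by assumption. now apply Hs.
Qed.

Lemma completely_monotonic_inversion (H : nat -> R -> R) (a : R) (j : nat) :
  derivative_chain H -> (forall k x, 0 < x -> 0 <= H k x) -> 0 <= a ->
  completely_monotonic (fun x => Rpower x (- a) * H j (/ x)).
Proof.
  intros HH Hpos Ha.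
  split; intros n; now apply alternating_spec, alternating_inversion.
Qed.

(** * Bernstein's theorem *)

Lemma ex_derive_n_chain (H : nat -> R -> R) : derivative_chain H ->
  forall n x, 0 < x -> ex_derive_n (H 0%nat) n x.
Proof. intros HH n x Hx. now apply (differentiable_pos_chain H HH n 0 n). Qed.

Lemma chain_nondecreasing (H : nat -> R -> R) :
  derivative_chain H -> (forall k x, 0 < x -> 0 <= H k x) ->
  forall k x y, 0 < x -> x <= y -> H k x <= H k y.
Proof.
  intros HH Hpos k x y Hx [Hxy| ->]; [|lra].
  destruct (MVT_gen (H k) x y (H (S k))) as [c [Hc Heq]].
  - intros t Ht. rewrite Rmin_left in Ht by lra. apply HH. lra.
  - intros t Ht. rewrite Rmin_left in Ht by lra.
    apply derivable_continuous_pt. exists (H (S k) t). apply is_derive_Reals, HH. lra.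
  - rewrite Rmin_left in Hc by lra.
    assert (0 <= H (S k) c) by (apply Hpos; lra). nra.
Qed.

Lemma Taylor_chain (H : nat -> R -> R) (n : nat) (x y : R) :
  derivative_chain H -> 0 < x < y ->
  exists z, x < z < y /\
    H 0%nat y = sum_f_R0 (fun m => (y - x) ^ m / INR (fact m) * H m x) n
                + (y - x) ^ S n / INR (fact (S n)) * H (S n) z.
Proof.
  intros HH [Hx Hxy].
  destruct (Taylor_Lagrange (H 0%nat) n x y Hxy) as [z [Hz Heq]].
  - intros t Ht k _. apply ex_derive_n_chain; [assumption | lra].
  - exists z. split; [assumption|]. rewrite Heq. rewrite (Derive_n_chain H HH) by lra.
    f_equal. apply sum_eq. intros i _. now rewrite (Derive_n_chain H HH) by lra.
Qed.

Lemma pow_div_fact_pos (x : R) (n : nat) : 0 < x -> 0 < x ^ n / INR (fact n).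
Proof.
  intros Hx. apply Rdiv_lt_0_compat; [now apply pow_lt | apply INR_fact_lt_0].
Qed.

(** As [H (S n)] is non-decreasing, the Lagrange remainder is at most the term of order [S n] with
    step [y] and derivative taken at [y]. The expansion of [H 0 (3 * y)] about [y] has step [2 * y],
    so its remainder is at least [2 ^ S n] times that term, and its other terms are non-negative. *)
Lemma Taylor_remainder_bounds (H : nat -> R -> R) (n : nat) (x y : R) :
  derivative_chain H -> (forall k x, 0 < x -> 0 <= H k x) -> 0 < x < y ->
  0 <= H 0%nat y - sum_f_R0 (fun m => (y - x) ^ m / INR (fact m) * H m x) n
    <= (1 / 2) ^ S n * H 0%nat (3 * y).
Proof.
  intros HH Hpos Hxy.
  destruct (Taylor_chain H n x y HH Hxy) as [z [Hz ->]].
  destruct (Taylor_chain H n y (3 * y) HH) as [w [Hw ->]]; [lra|].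
  assert (Hsum : 0 <= sum_f_R0 (fun m => (3 * y - y) ^ m / INR (fact m) * H m y) n).
  { apply cond_pos_sum. intros m. apply Rmult_le_pos.
    - apply Rlt_le, pow_div_fact_pos. lra.
    - apply Hpos. lra. }
  assert (H1 := chain_nondecreasing H HH Hpos (S n) z y ltac:(lra) ltac:(lra)).
  assert (H2 := chain_nondecreasing H HH Hpos (S n) y w ltac:(lra) ltac:(lra)).
  assert (H3 := Hpos (S n) z ltac:(lra)).
  assert (P1 := pow_div_fact_pos (y - x) (S n) ltac:(lra)).
  assert (P2 := pow_div_fact_pos y (S n) ltac:(lra)).
  assert (P3 : (y - x) ^ S n / INR (fact (S n)) <= y ^ S n / INR (fact (S n))).
  { apply Rmult_le_compat_r.
    - apply Rlt_le, Rinv_0_lt_compat, INR_fact_lt_0.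
    - apply pow_incr. lra. }
  set (s1 := sum_f_R0 _ _). set (s2 := sum_f_R0 _ _) in *.
  split.
  - assert (0 <= (y - x) ^ S n / INR (fact (S n)) * H (S n) z) by nra. lra.
  - assert (E : (1 / 2) ^ S n * ((3 * y - y) ^ S n / INR (fact (S n)) * H (S n) w)
             = y ^ S n / INR (fact (S n)) * H (S n) w).
    { replace ((3 * y - y) ^ S n) with (2 ^ S n * y ^ S n)
        by (rewrite <- Rpow_mult_distr; f_equal; ring).
      assert (E : (1 / 2) ^ S n * 2 ^ S n = 1)
        by (rewrite <- Rpow_mult_distr; replace (1 / 2 * 2) with 1 by field; apply pow1).
      unfold Rdiv in *.
      transitivity (((1 * / 2) ^ S n * 2 ^ S n) * (y ^ S n * / INR (fact (S n)) * H (S n) w)).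
      - ring.
      - rewrite E. ring. }
    rewrite Rmult_plus_distr_l, E.
    assert (0 <= (1 / 2) ^ S n * s2) by (apply Rmult_le_pos; [apply pow_le; lra | lra]).
    assert ((y - x) ^ S n / INR (fact (S n)) * H (S n) z
            <= y ^ S n / INR (fact (S n)) * H (S n) w)
      by (apply Rmult_le_compat; lra).
    lra.
Qed.

(** Each derivative decreases towards 0 and is bounded below, so it has a finite limit there.
    Divided by factorials, these limits become the Taylor coefficients at 0. *)
Lemma chain_limit_at_0 (H : nat -> R -> R) :
  derivative_chain H -> (forall k x, 0 < x -> 0 <= H k x) ->
  forall k, let c := real (Lim_seq (fun m => H k (/ INR (S m)))) in
    0 <= c /\ is_lim_seq (fun m => H k (/ INR (S m))) c.
Proof.
  intros HH Hpos k.
  assert (Hp : forall m, 0 < / INR (S m)).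
  { intros m. apply Rinv_0_lt_compat, lt_0_INR. lia. }
  destruct (ex_finite_lim_seq_decr (fun m => H k (/ INR (S m))) 0) as [c Hc].
  - intros m. apply chain_nondecreasing; auto.
    apply Rinv_le_contravar; [apply lt_0_INR; lia | apply le_INR; lia].
  - intros m. now apply Hpos.
  - rewrite (is_lim_seq_unique _ _ Hc). split; [|exact Hc].
    apply (is_lim_seq_le (fun _ => 0) (fun m => H k (/ INR (S m))) 0 c).
    + intros m. now apply Hpos.
    + apply is_lim_seq_const.
    + exact Hc.
Qed.

Lemma is_lim_seq_sum_f_R0 (u : nat -> nat -> R) (l : nat -> R) (n : nat) :
  (forall k, is_lim_seq (u k) (l k)) ->
  is_lim_seq (fun m => sum_f_R0 (fun k => u k m) n) (sum_f_R0 l n).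
Proof.
  intros Hu. induction n as [|n IH]; simpl; [apply Hu|].
  now apply is_lim_seq_plus'.
Qed.

Lemma is_lim_seq_inv_S : is_lim_seq (fun m => / INR (S m)) 0.
Proof.
  apply (is_lim_seq_inv (fun m => INR (S m)) p_infty).
  - apply (is_lim_seq_incr_1 INR). apply is_lim_seq_INR.
  - discriminate.
Qed.

(* Bernstein: expand around [1/(m+1)] and let [m] tend to infinity; the remainder
   bound does not depend on the centre of the expansion. *)
Lemma chain_power_series (H : nat -> R -> R) :
  derivative_chain H -> (forall k x, 0 < x -> 0 <= H k x) ->
  exists b : nat -> R, (forall n, 0 <= b n) /\
    forall y, 0 < y -> is_series (fun n => b n * y ^ n) (H 0%nat y).
Proof.
  intros HH Hpos.
  pose proof (chain_limit_at_0 H HH Hpos) as Hc.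
  set (c := fun k => real (Lim_seq (fun m => H k (/ INR (S m))))).
  change (forall k, 0 <= c k /\ is_lim_seq (fun m => H k (/ INR (S m))) (c k)) in Hc.
  exists (fun n => c n / INR (fact n)). split.
  { intros n. apply Rmult_le_pos; [apply Hc|].
    apply Rlt_le, Rinv_0_lt_compat, INR_fact_lt_0. }
  intros y Hy.
  assert (Hp : forall m, 0 < / INR (S m)).
  { intros m. apply Rinv_0_lt_compat, lt_0_INR. lia. }
  set (s := fun n => sum_f_R0 (fun k => c k / INR (fact k) * y ^ k) n).
  assert (Hs : forall n, 0 <= H 0%nat y - s n <= (1 / 2) ^ S n * H 0%nat (3 * y)).
  { intros n.
    set (v := fun m => H 0%nat y -
      sum_f_R0 (fun k => (y - / INR (S m)) ^ k / INR (fact k) * H k (/ INR (S m))) n).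
    assert (Hv : is_lim_seq v (H 0%nat y - s n)).
    { apply is_lim_seq_minus'; [apply is_lim_seq_const|].
      apply (is_lim_seq_sum_f_R0 (fun k m =>
        (y - / INR (S m)) ^ k / INR (fact k) * H k (/ INR (S m)))).
      intros k. replace (c k / INR (fact k) * y ^ k)
        with ((y - 0) ^ k / INR (fact k) * c k)
        by (rewrite Rminus_0_r; field; apply INR_fact_neq_0).
      apply is_lim_seq_mult'; [|apply Hc].
      apply (is_lim_seq_continuous (fun t => (y - t) ^ k / INR (fact k))
               (fun m => / INR (S m)) 0); [|exact is_lim_seq_inv_S].
      apply derivable_continuous_pt. eexists. apply is_derive_Reals.
      auto_derive; [exact I | reflexivity]. }
    (* The remainder bound requires the centre [/ INR (S m)] to lie left of [y], which holds for all
       large [m]. *)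
    assert (Hev : Hierarchy.eventually (fun m => 0 <= v m <= (1 / 2) ^ S n * H 0%nat (3 * y))).
    { destruct (proj1 (is_lim_seq_Reals _ _) is_lim_seq_inv_S y Hy) as [N HN].
      exists N. intros m Hm. specialize (HN m Hm). specialize (Hp m).
      unfold Rdist in HN. rewrite Rminus_0_r, Rabs_pos_eq in HN by lra.
      apply Taylor_remainder_bounds; auto. }
    split.
    - refine (is_lim_seq_le_loc (fun _ => 0) v 0 (H 0%nat y - s n) _ (is_lim_seq_const 0) Hv).
      apply filter_imp with (2 := Hev). tauto.
    - refine (is_lim_seq_le_loc v (fun _ => (1 / 2) ^ S n * H 0%nat (3 * y))
        (H 0%nat y - s n) ((1 / 2) ^ S n * H 0%nat (3 * y)) _ Hv (is_lim_seq_const _)).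
      apply filter_imp with (2 := Hev). tauto. }
  change (is_lim_seq (sum_n (fun n => c n / INR (fact n) * y ^ n)) (H 0%nat y)).
  apply is_lim_seq_ext with s.
  { intros n. symmetry. apply sum_n_Reals. }
  (* This form of the limit is the one that the limit rules yield for the lower side of the
     squeeze. *)
  replace (Finite (H 0%nat y)) with (Rbar_minus (H 0%nat y) (0 * H 0%nat (3 * y)))
    by (simpl; f_equal; ring).
  apply is_lim_seq_le_le with
    (u := fun n => H 0%nat y - (1 / 2) ^ S n * H 0%nat (3 * y)) (w := fun _ => H 0%nat y).
  - intros n. specialize (Hs n). lra.
  - apply is_lim_seq_minus'; [apply is_lim_seq_const|].
    apply is_lim_seq_mult'; [|apply is_lim_seq_const].
    apply (is_lim_seq_incr_1 (fun n => (1 / 2) ^ n)).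
    apply is_lim_seq_geom. rewrite Rabs_pos_eq; lra.
  - simpl. rewrite Rmult_0_l, Ropp_0, Rplus_0_r. apply is_lim_seq_const.
Qed.

(** * Integrals over the positive half-line *)

Definition continuous_pos (g : R -> R) : Prop := forall t, 0 < t -> continuous g t.

Lemma ex_RInt_pos (g : R -> R) (a b : R) :
  continuous_pos g -> 0 < a -> 0 < b -> ex_RInt g a b.
Proof.
  intros Hg Ha Hb. apply (ex_RInt_continuous (V := R_CompleteNormedModule)).
  intros z [Hz _]. apply Hg. now apply Rlt_le_trans with (1 := Rmin_pos a b Ha Hb).
Qed.

Definition interval_integrals (g : R -> R) (v : R) : Prop :=
  exists a b, 0 < a <= b /\ v = RInt g a b.

Lemma RInt_pos_subset (g : R -> R) (a' a b b' : R) :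
  continuous_pos g -> (forall t, 0 < t -> 0 <= g t) ->
  0 < a' -> a' <= a -> a <= b -> b <= b' -> RInt g a b <= RInt g a' b'.
Proof.
  intros Hg Hpos Ha' Ha Hab Hb.
  pose proof (RInt_Chasles g a' a b' (ex_RInt_pos g a' a Hg ltac:(lra) ltac:(lra))
    (ex_RInt_pos g a b' Hg ltac:(lra) ltac:(lra))) as E1.
  pose proof (RInt_Chasles g a b b' (ex_RInt_pos g a b Hg ltac:(lra) ltac:(lra))
    (ex_RInt_pos g b b' Hg ltac:(lra) ltac:(lra))) as E2.
  change plus with Rplus in E1, E2.
  assert (0 <= RInt g a' a).
  { apply RInt_ge_0; [lra | apply ex_RInt_pos; auto; lra | intros t Ht; apply Hpos; lra]. }
  assert (0 <= RInt g b b').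
  { apply RInt_ge_0; [lra | apply ex_RInt_pos; auto; lra | intros t Ht; apply Hpos; lra]. }
  lra.
Qed.

Lemma is_RInt_gen_pos_approx (g : R -> R) (l : R) :
  is_RInt_gen g (at_right 0) (Rbar_locally p_infty) l ->
  forall eps a b, 0 < eps -> 0 < a ->
    exists a' b', 0 < a' < a /\ b < b' /\ Rabs (RInt g a' b' - l) < eps.
Proof.
  intros Hl eps a b Heps Ha.
  destruct (Hl (ball l eps) (locally_ball l (mkposreal eps Heps))) as [Q S HQ HS HQS].
  destruct HQ as [d Hd]. destruct HS as [M HM].
  set (a' := Rmin (d / 2) (a / 2)). set (b' := Rmax (b + 1) (M + 1)).
  pose proof (cond_pos d) as Hdp.
  assert (Ha' : 0 < a' < a /\ a' < d).
  { unfold a'. pose proof (Rmin_l (d / 2) (a / 2)). pose proof (Rmin_r (d / 2) (a / 2)).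
    assert (0 < Rmin (d / 2) (a / 2)) by (apply Rmin_pos; lra). lra. }
  assert (Hb' : b < b' /\ M < b').
  { unfold b'. pose proof (Rmax_l (b + 1) (M + 1)). pose proof (Rmax_r (b + 1) (M + 1)). lra. }
  destruct (HQS a' b') as [v [Hv Hball]].
  - apply Hd; [|lra]. change (Rabs (a' - 0) < d). rewrite Rminus_0_r, Rabs_pos_eq; lra.
  - apply HM. lra.
  - exists a', b'. repeat split; try lra.
    simpl in Hv. rewrite (is_RInt_unique _ _ _ _ Hv). exact Hball.
Qed.

(** Integrals of a non-negative function grow with the interval. Once one interval comes within
    [eps] of the supremum, every larger one does too; conversely, no interval integral can exceed
    the limit along larger intervals. *)
Lemma is_RInt_gen_pos_iff_lub (g : R -> R) (l : R) :
  continuous_pos g -> (forall t, 0 < t -> 0 <= g t) ->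
  is_RInt_gen g (at_right 0) (Rbar_locally p_infty) l <-> is_lub (interval_integrals g) l.
Proof.
  intros Hg Hpos. split.
  - intros Hl. pose proof (is_RInt_gen_pos_approx g l Hl) as Happ. split.
    + intros v [a [b [Hab ->]]]. apply Rnot_lt_le. intros Hlt.
      destruct (Happ (RInt g a b - l) a b) as [a' [b' [Ha' [Hb' Habs]]]]; [lra | lra |].
      pose proof (RInt_pos_subset g a' a b b' Hg Hpos
        ltac:(lra) ltac:(lra) ltac:(lra) ltac:(lra)).
      pose proof (Rle_abs (RInt g a' b' - l)). lra.
    + intros M HM. apply Rnot_lt_le. intros Hlt.
      destruct (Happ (l - M) 1 1) as [a' [b' [Ha' [Hb' Habs]]]]; [lra | lra |].
      assert (RInt g a' b' <= M) by (apply HM; exists a', b'; split; [lra | reflexivity]).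
      pose proof (Rle_abs (- (RInt g a' b' - l))) as Hr. rewrite Rabs_Ropp in Hr. lra.
  - intros [Hub Hleast] P [eps HP]. pose proof (cond_pos eps) as Heps.
    assert (Hab : exists a b, 0 < a <= b /\ l - eps < RInt g a b).
    { apply Classical_Prop.NNPP. intros Hn.
      assert (l <= l - eps); [|lra].
      apply Hleast. intros v [a [b [Hab ->]]]. apply Rnot_lt_le. intros Hlt.
      apply Hn. now exists a, b. }
    destruct Hab as [a [b [Hab Hlt]]].
    exists (fun x => 0 < x < a) (fun y => b < y).
    + exists (mkposreal a (proj1 Hab)). intros y Hy Hy0. split; [exact Hy0|].
      change (Rabs (y - 0) < a) in Hy. rewrite Rminus_0_r, Rabs_pos_eq in Hy; lra.
    + now exists b.
    + intros x y Hx Hy. exists (RInt g x y). split.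
      * apply (RInt_correct (V := R_CompleteNormedModule)), ex_RInt_pos; auto; lra.
      * apply HP. change (Rabs (RInt g x y - l) < eps).
        assert (RInt g x y <= l) by (apply Hub; exists x, y; split; [lra | reflexivity]).
        pose proof (RInt_pos_subset g x a b y Hg Hpos
          ltac:(lra) ltac:(lra) ltac:(lra) ltac:(lra)).
        apply Rabs_def1; lra.
Qed.

Lemma interval_integrals_ext (f g : R -> R) (l : R) :
  (forall t, 0 < t -> f t = g t) ->
  is_lub (interval_integrals f) l -> is_lub (interval_integrals g) l.
Proof.
  intros Hfg [H1 H2].
  assert (E : forall v, interval_integrals f v <-> interval_integrals g v).
  { intros v. split; intros [a [b [Hab ->]]]; exists a, b; (split; [assumption|]);
      apply RInt_ext; intros t [Ht _]; rewrite Rmin_left in Ht by lra;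
      [|symmetry]; apply Hfg; lra. }
  split.
  - intros v Hv. now apply H1, E.
  - intros M HM. apply H2. intros v Hv. now apply HM, E.
Qed.

(** * Termwise integration of power series *)

Lemma series_partial_sum_le (u : nat -> R) (l : R) (N : nat) :
  (forall n, 0 <= u n) -> is_series u l -> sum_n u N <= l.
Proof.
  intros Hu Hl. refine (is_lim_seq_incr_compare (sum_n u) l Hl _ N).
  intros n. rewrite sum_Sn. specialize (Hu (S n)). change plus with Rplus. lra.
Qed.

Lemma series_le_of_partial_sums (u : nat -> R) (l M : R) :
  (forall N, sum_n u N <= M) -> is_series u l -> l <= M.
Proof.
  intros HM Hl.
  exact (is_lim_seq_le (sum_n u) (fun _ => M) l M HM Hl (is_lim_seq_const M)).
Qed.

Lemma continuous_pos_mult (f g : R -> R) :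
  continuous_pos f -> continuous_pos g -> continuous_pos (fun t => f t * g t).
Proof. intros Hf Hg t Ht. apply (continuous_mult f g t); auto. Qed.

(** Beyond a finite radius [r], for instance at [r + 1], the terms would not tend to 0. *)
Lemma CV_radius_p_infty (a : nat -> R) :
  (forall t, 0 < t -> ex_series (fun n => a n * t ^ n)) -> CV_radius a = p_infty.
Proof.
  intros Ha. pose proof (CV_radius_ge_0 a) as H0.
  pose proof (fun t => CV_disk_outside a t) as Hout.
  destruct (CV_radius a) as [r| |]; [|reflexivity | contradiction].
  simpl in H0. exfalso. apply (Hout (r + 1)).
  - simpl. rewrite Rabs_pos_eq; lra.
  - apply ex_series_lim_0, Ha. lra.
Qed.

Lemma PSeries_entire (a : nat -> R) (t : R) :
  CV_radius a = p_infty -> is_series (fun n => a n * t ^ n) (PSeries a t).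
Proof.
  intros Ha. apply is_pseries_R, PSeries_correct, CV_radius_inside. now rewrite Ha.
Qed.

Lemma PSeries_entire_continuous (a : nat -> R) : CV_radius a = p_infty ->
  forall t, continuous (PSeries a) t.
Proof.
  intros Ha t. apply (ex_derive_continuous (V := R_NormedModule)).
  eexists. apply is_derive_PSeries. now rewrite Ha.
Qed.

Lemma power_sum_continuous (a : nat -> R) (N : nat) (t : R) :
  continuous (fun t => sum_n (fun n => a n * t ^ n) N) t.
Proof.
  assert (Ht : forall n t, continuous (fun t => a n * t ^ n) t).
  { intros n s. apply (ex_derive_continuous (V := R_NormedModule)). now auto_derive. }
  induction N as [|N IH].
  - refine (continuous_ext _ _ _ _ (Ht 0%nat t)). intros s. now rewrite sum_O.
  - refine (continuous_ext _ _ _ _ (continuous_plus _ _ t IH (Ht (S N) t))).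
    intros s. now rewrite sum_Sn.
Qed.

Lemma power_sum_integral (w : R -> R) (a m : nat -> R) (N : nat) :
  (forall n, is_RInt_gen (fun t => w t * t ^ n) (at_right 0) (Rbar_locally p_infty) (m n)) ->
  is_RInt_gen (fun t => w t * sum_n (fun n => a n * t ^ n) N)
    (at_right 0) (Rbar_locally p_infty) (sum_n (fun n => a n * m n) N).
Proof.
  intros Hm.
  assert (Ht : forall n, is_RInt_gen (fun t => w t * (a n * t ^ n))
    (at_right 0) (Rbar_locally p_infty) (a n * m n)).
  { intros n. refine (is_RInt_gen_ext _ _ _ _ (is_RInt_gen_scal _ (a n) _ (Hm n))).
    apply filter_forall. intros ab t _. unfold scal; simpl; unfold mult; simpl. ring. }
  induction N as [|N IH].
  - rewrite sum_O. refine (is_RInt_gen_ext _ _ _ _ (Ht 0%nat)).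
    apply filter_forall. intros ab t _. now rewrite sum_O.
  - rewrite sum_Sn.
    refine (is_RInt_gen_ext _ _ _ _ (is_RInt_gen_plus _ _ _ _ IH (Ht (S N)))).
    apply filter_forall. intros ab t _. rewrite sum_Sn.
    unfold plus; simpl. ring.
Qed.

Lemma is_RInt_plus_scal (f g : R -> R) (c x y : R) :
  ex_RInt f x y -> ex_RInt g x y ->
  is_RInt (fun t => f t + c * g t) x y (RInt f x y + c * RInt g x y).
Proof.
  intros Hf Hg.
  exact (is_RInt_plus f (fun t => scal c (g t)) x y _ _
    (RInt_correct (V := R_CompleteNormedModule) f x y Hf)
    (is_RInt_scal g x y c _ (RInt_correct (V := R_CompleteNormedModule) g x y Hg))).
Qed.

(** The two tails differ by the sum of the non-negative terms [a n * (t ^ n - s ^ n)] with [n > N].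
    This takes the place of uniform convergence: on an interval the error of a partial sum is
    controlled by its value at the right end. *)
Lemma power_tail_nondecreasing (a : nat -> R) (N : nat) (s t : R) :
  (forall n, 0 <= a n) -> CV_radius a = p_infty -> 0 <= s <= t ->
  PSeries a s - sum_n (fun n => a n * s ^ n) N
  <= PSeries a t - sum_n (fun n => a n * t ^ n) N.
Proof.
  intros Ha Hr Hst.
  assert (H : is_series (fun n => a n * t ^ n - a n * s ^ n) (PSeries a t - PSeries a s)).
  { apply (is_series_minus (fun n => a n * t ^ n) (fun n => a n * s ^ n));
      now apply PSeries_entire. }
  apply (series_partial_sum_le _ _ N) in H.
  - assert (E : sum_n (fun n => a n * t ^ n - a n * s ^ n) N
      = sum_n (fun n => a n * t ^ n) N - sum_n (fun n => a n * s ^ n) N).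
    { rewrite !sum_n_Reals. now rewrite <- minus_sum. }
    rewrite E in H. lra.
  - intros n. pose proof (pow_incr s t n Hst). specialize (Ha n). nra.
Qed.

(* Monotone convergence by hand: on [[x, y]] the tail of the power series is at most
   its value at [y], so the partial sums may be integrated termwise there. *)
Lemma is_RInt_gen_PSeries (w : R -> R) (a m : nat -> R) (l : R) :
  continuous_pos w -> (forall t, 0 < t -> 0 <= w t) ->
  (forall n, 0 <= a n) -> CV_radius a = p_infty ->
  (forall n, is_RInt_gen (fun t => w t * t ^ n) (at_right 0) (Rbar_locally p_infty) (m n)) ->
  is_RInt_gen (fun t => w t * PSeries a t) (at_right 0) (Rbar_locally p_infty) l
  <-> is_series (fun n => a n * m n) l.
Proof.
  intros Hw Hw0 Ha Hr Hm.
  set (S_ := fun (N : nat) (t : R) => sum_n (fun n => a n * t ^ n) N : R).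
  set (phi := PSeries a).
  assert (HS0 : forall N t, 0 < t -> 0 <= S_ N t).
  { intros N t Ht. unfold S_. rewrite sum_n_Reals. apply cond_pos_sum.
    intros n. apply Rmult_le_pos; [apply Ha | apply pow_le; lra]. }
  assert (HSphi : forall N t, 0 < t -> S_ N t <= phi t).
  { intros N t Ht. apply series_partial_sum_le; [|now apply PSeries_entire].
    intros n. apply Rmult_le_pos; [apply Ha | apply pow_le; lra]. }
  assert (Cphi : continuous_pos (fun t => w t * phi t)).
  { apply continuous_pos_mult; [exact Hw|]. intros t _. now apply PSeries_entire_continuous. }
  assert (CS : forall N, continuous_pos (fun t => w t * S_ N t)).
  { intros N. apply continuous_pos_mult; [exact Hw|]. intros t _. apply power_sum_continuous. }
  assert (HS : forall N, is_lub (interval_integrals (fun t => w t * S_ N t))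
                            (sum_n (fun n => a n * m n) N)).
  { intros N. apply is_RInt_gen_pos_iff_lub; [apply CS | | now apply power_sum_integral].
    intros t Ht. apply Rmult_le_pos; auto. }
  (* The partial sums lie below [phi], so any bound on the integrals of [w t * phi t] also bounds
     the partial sums of the moment series. *)
  assert (Hpart : forall M, is_upper_bound (interval_integrals (fun t => w t * phi t)) M ->
            forall N, sum_n (fun n => a n * m n) N <= M).
  { intros M HM N. apply (HS N). intros v [x [y [Hxy ->]]].
    apply Rle_trans with (RInt (fun t => w t * phi t) x y).
    - apply RInt_le; [lra | apply ex_RInt_pos; auto; lra | apply ex_RInt_pos; auto; lra |].
      intros t Ht. apply Rmult_le_compat_l; [apply Hw0 | apply HSphi]; lra.
    - apply HM. now exists x, y. }
  assert (Hm0 : forall n, 0 <= a n * m n).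
  { intros n. apply Rmult_le_pos; [apply Ha|].
    assert (Hl : is_lub (interval_integrals (fun t => w t * t ^ n)) (m n)).
    { apply is_RInt_gen_pos_iff_lub; [| | apply Hm].
      - apply continuous_pos_mult; [exact Hw|]. intros t _.
        apply (ex_derive_continuous (V := R_NormedModule)). now auto_derive.
      - intros t Ht. apply Rmult_le_pos; [auto | apply pow_le; lra]. }
    (* The degenerate interval at 1 contributes the value 0, and the moment is an upper bound. *)
    apply Hl. exists 1, 1. split; [lra|]. symmetry. exact (RInt_point 1 (fun t => w t * t ^ n)). }
  assert (Hback : forall l : R, is_series (fun n => a n * m n) l ->
            is_lub (interval_integrals (fun t => w t * phi t)) l).
  { intros s Hs. split.
    2: { intros M HM. apply (series_le_of_partial_sums _ _ _ (Hpart M HM) Hs). }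
    intros v [x [y [Hxy ->]]].
    (* [K] does not depend on [N]: the tail at [y] times [K] bounds the integrated error on [[x, y]]
       and vanishes as [N] grows. *)
    set (K := RInt w x y).
    assert (Hbound : forall N, RInt (fun t => w t * phi t) x y
                       <= s + (phi y - S_ N y) * K).
    { intros N.
      pose proof (is_RInt_plus_scal (fun t => w t * S_ N t) w (phi y - S_ N y) x y
        (ex_RInt_pos _ x y (CS N) ltac:(lra) ltac:(lra))
        (ex_RInt_pos w x y Hw ltac:(lra) ltac:(lra))) as E.
      apply Rle_trans with (RInt (fun t => w t * S_ N t + (phi y - S_ N y) * w t) x y).
      - apply RInt_le; [lra | apply ex_RInt_pos; auto; lra | |].
        + eexists. exact E.
        + intros t Ht.
          pose proof (power_tail_nondecreasing a N t y Ha Hr ltac:(lra)) as Htail.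
          fold phi in Htail. change (phi t - S_ N t <= phi y - S_ N y) in Htail.
          pose proof (Hw0 t ltac:(lra)). nra.
      - rewrite (is_RInt_unique _ _ _ _ E). apply Rplus_le_compat_r.
        apply Rle_trans with (sum_n (fun n => a n * m n) N).
        + apply (HS N). now exists x, y.
        + now apply series_partial_sum_le. }
    assert (Hlim : is_lim_seq (fun N => s + (phi y - S_ N y) * K) (s + (phi y - phi y) * K)).
    { apply is_lim_seq_plus'; [apply is_lim_seq_const|].
      apply is_lim_seq_mult'; [|apply is_lim_seq_const].
      apply is_lim_seq_minus'; [apply is_lim_seq_const|].
      exact (PSeries_entire a y Hr). }
    replace s with (s + (phi y - phi y) * K) by ring.
    exact (is_lim_seq_le (fun _ => _) _ (Finite _) (Finite _) Hbound (is_lim_seq_const _) Hlim). }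
  rewrite is_RInt_gen_pos_iff_lub; [| exact Cphi |].
  2: { intros t Ht. apply Rmult_le_pos; [auto|]. apply Rle_trans with (S_ 0%nat t); auto. }
  split; [|apply Hback].
  intros Hl.
  (* The increasing partial sums are bounded by [l], hence converge to some [s]. By [Hback] this [s]
     is also the supremum, so it equals [l]. *)
  assert (Hex : ex_series (fun n => a n * m n)).
  { destruct (ex_finite_lim_seq_incr (sum_n (fun n => a n * m n)) l) as [s Hs].
    - intros N. rewrite sum_Sn. pose proof (Hm0 (S N)). change plus with Rplus. lra.
    - apply Hpart, Hl.
    - now exists s. }
  destruct Hex as [s Hs].
  now rewrite (is_lub_u _ _ _ Hl (Hback s Hs)).
Qed.

(** * Gamma integrals *)

Definition laplace_weight (s x t : R) : R := exp (- (x * t)) * Rpower t (s - 1).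

Lemma laplace_weight_pos (s x t : R) : 0 < laplace_weight s x t.
Proof. apply Rmult_lt_0_compat; apply exp_pos. Qed.

Lemma continuous_pos_Rpower (a : R) : continuous_pos (fun t => Rpower t a).
Proof.
  intros t Ht. apply (ex_derive_continuous (V := R_NormedModule)).
  eexists. now apply is_derive_Rpower.
Qed.

Lemma continuous_pos_laplace_weight (s x : R) : continuous_pos (laplace_weight s x).
Proof.
  apply (continuous_pos_mult (fun t => exp (- (x * t)))); [|apply continuous_pos_Rpower].
  intros t _. apply (ex_derive_continuous (V := R_NormedModule)). now auto_derive.
Qed.

Lemma exp_nondecreasing (x y : R) : x <= y -> exp x <= exp y.
Proof. intros [Hxy| ->]; [now apply Rlt_le, exp_increasing | lra]. Qed.

(** The constant is the maximum of [u^p e^(-u)], attained at [u = p]. The inequality is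
    [ln v <= v - 1] at [v = u / p], multiplied by [p]. *)
Lemma exp_dominates_Rpower (p u : R) :
  0 < p -> 0 < u -> Rpower u p <= exp (p * ln p - p) * exp u.
Proof.
  intros Hp Hu. unfold Rpower. rewrite <- exp_plus. apply exp_nondecreasing.
  assert (Hup : 0 < u / p) by now apply Rdiv_lt_0_compat.
  assert (H : ln (u / p) <= u / p - 1).
  { pose proof (exp_ineq1_le (ln (u / p))) as H. rewrite exp_ln in H by assumption. lra. }
  rewrite ln_div in H by assumption.
  apply (Rmult_le_compat_l p) in H; [|lra].
  replace (p * (u / p - 1)) with (u - p) in H by (field; lra). lra.
Qed.

(* [(t / (1 + t))^s] is bounded and its derivative is [s t^(s-1) / (1 + t)^(s+1)],
   which dominates a constant multiple of the Gamma integrand at both ends. *)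
Lemma Gamma_integrals_bounded (s : R) : 0 < s ->
  bound (interval_integrals (laplace_weight s 1)).
Proof.
  intros Hs.
  (* [C] is chosen so that [(1 + t)^(s+1) <= C e^t]: this is [exp_dominates_Rpower] with exponent
     [s + 1] at [1 + t], and [exp 1] comes from splitting [e^(1+t)]. *)
  set (C := exp ((s + 1) * ln (s + 1) - (s + 1)) * exp 1).
  set (B := fun t => Rpower (t / (1 + t)) s).
  set (B' := fun t => s * Rpower (t / (1 + t)) (s - 1) * (1 / (1 + t) ^ 2)).
  assert (Hq : forall t, 0 < t -> 0 < t / (1 + t)).
  { intros t Ht. apply Rdiv_lt_0_compat; lra. }
  assert (HB : forall t, 0 < t -> is_derive B t (B' t)).
  { intros t Ht.
    assert (Hd : is_derive (fun t => t / (1 + t)) t (1 / (1 + t) ^ 2)).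
    { auto_derive; [lra|]. field. lra. }
    refine (is_derive_eq _ _ _ _ (is_derive_comp (fun u => Rpower u s) _ t _ _
      (is_derive_Rpower s _ (Hq t Ht)) Hd) _).
    unfold scal; simpl; unfold mult; simpl. unfold B'. simpl. ring. }
  assert (CB' : continuous_pos B').
  { apply (continuous_pos_mult (fun t => s * Rpower (t / (1 + t)) (s - 1))).
    - apply (continuous_pos_mult (fun _ => s)); [intros t _; apply continuous_const|].
      intros t Ht.
      apply (continuous_comp (fun t => t / (1 + t)) (fun u => Rpower u (s - 1))).
      + apply (ex_derive_continuous (V := R_NormedModule)). auto_derive. lra.
      + apply continuous_pos_Rpower. auto.
    - intros t Ht. apply (ex_derive_continuous (V := R_NormedModule)). auto_derive.
      apply Rgt_not_eq. nra. }
  assert (Hdom : forall t, 0 < t -> laplace_weight s 1 t <= C / s * B' t).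
  { intros t Ht. unfold laplace_weight, B'.
    pose proof (exp_dominates_Rpower (s + 1) (1 + t) ltac:(lra) ltac:(lra)) as Hexp.
    rewrite exp_plus in Hexp.
    replace (Rpower (t / (1 + t)) (s - 1))
      with (Rpower t (s - 1) * / Rpower (1 + t) (s - 1)).
    2: { rewrite <- Rpower_Ropp. unfold Rpower. rewrite ln_div, <- exp_plus by lra.
         f_equal. ring. }
    assert (E : Rpower (1 + t) (s + 1) = Rpower (1 + t) (s - 1) * (1 + t) ^ 2).
    { rewrite <- (Rpower_pow 2) by lra. rewrite <- Rpower_plus. f_equal. simpl. ring. }
    rewrite E in Hexp.
    assert (HR : 0 < Rpower (1 + t) (s - 1)) by apply exp_pos.
    assert (HT : 0 < Rpower t (s - 1)) by apply exp_pos.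
    rewrite Rmult_1_l, exp_Ropp.
    assert (He : 0 < exp t) by apply exp_pos.
    set (P := Rpower (1 + t) (s - 1)) in *. set (Q := Rpower t (s - 1)) in *.
    assert (HD : 0 < (1 + t) ^ 2) by (apply pow_lt; lra).
    set (D := (1 + t) ^ 2) in *.
    assert (HPD : 0 < P * D) by now apply Rmult_lt_0_compat.
    replace (C / s * (s * (Q * / P) * (1 / D))) with (C / (P * D) * Q)
      by (field; repeat split; lra).
    apply Rmult_le_compat_r; [lra|].
    apply (Rmult_le_reg_r (exp t * (P * D))); [now apply Rmult_lt_0_compat|].
    replace (/ exp t * (exp t * (P * D))) with (P * D) by (field; lra).
    replace (C / (P * D) * (exp t * (P * D))) with (C * exp t)
      by (field; repeat split; lra).
    unfold C. lra. }
  exists (C / s). intros v [a [b [Hab ->]]].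
  assert (Hint : is_RInt (fun t => C / s * B' t) a b (C / s * (B b - B a))).
  { apply (is_RInt_scal B' a b (C / s) (B b - B a)).
    apply (is_RInt_derive B B').
    - intros t [Ht _]. rewrite Rmin_left in Ht by lra. apply HB. lra.
    - intros t [Ht _]. rewrite Rmin_left in Ht by lra. apply CB'. lra. }
  apply Rle_trans with (RInt (fun t => C / s * B' t) a b).
  - apply RInt_le; [lra | apply ex_RInt_pos; [apply continuous_pos_laplace_weight | lra | lra]
                   | eexists; exact Hint |].
    intros t Ht. apply Hdom. lra.
  - rewrite (is_RInt_unique _ _ _ _ Hint).
    assert (HC : 0 < C / s).
    { apply Rdiv_lt_0_compat; [|assumption]. apply Rmult_lt_0_compat; apply exp_pos. }
    assert (0 < B a) by apply exp_pos.
    assert (B b <= 1).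
    { rewrite <- exp_0. apply exp_nondecreasing.
      assert (ln (b / (1 + b)) <= 0); [|nra].
      rewrite <- ln_1. apply Rlt_le, ln_increasing; [apply Hq; lra|].
      apply (Rmult_lt_reg_r (1 + b)); [lra|].
      unfold Rdiv. rewrite Rmult_assoc, Rinv_l, Rmult_1_r by lra. lra. }
    nra.
Qed.

Lemma laplace_weight_scaling (s x a b : R) : 0 < x -> 0 < a <= b ->
  RInt (laplace_weight s x) a b
  = Rpower x (- s) * RInt (laplace_weight s 1) (x * a) (x * b).
Proof.
  intros Hx Hab. apply is_RInt_unique.
  (* The [+ 0] matches the affine substitution [u = x * t + 0]; afterwards the powers [x], [x^(s-1)]
     and [x^(-s)] cancel. *)
  assert (Hint : is_RInt (laplace_weight s 1) (x * a + 0) (x * b + 0)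
                   (RInt (laplace_weight s 1) (x * a) (x * b))).
  { rewrite !Rplus_0_r. apply (RInt_correct (V := R_CompleteNormedModule)), ex_RInt_pos.
    - apply continuous_pos_laplace_weight.
    - nra.
    - nra. }
  apply (is_RInt_comp_lin (V := R_NormedModule)) in Hint.
  apply (is_RInt_scal _ a b (Rpower x (- s))) in Hint.
  refine (is_RInt_ext _ _ _ _ _ _ Hint).
  intros t [Ht _]. rewrite Rmin_left in Ht by lra.
  unfold scal; simpl; unfold mult; simpl. unfold laplace_weight.
  rewrite Rplus_0_r, Rmult_1_l, <- Rpower_mult_distr by lra.
  rewrite <- (Rpower_1 x) at 2 by assumption.
  replace (Rpower x (- s) * (Rpower x 1 * (exp (- (x * t)) *
    (Rpower x (s - 1) * Rpower t (s - 1)))))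
    with ((Rpower x (- s) * (Rpower x 1 * Rpower x (s - 1)))
          * (exp (- (x * t)) * Rpower t (s - 1))) by ring.
  rewrite <- !Rpower_plus. replace (- s + (1 + (s - 1))) with 0 by ring.
  rewrite Rpower_O by assumption. ring.
Qed.

Definition Gamma (s : R) : R :=
  RInt_gen (laplace_weight s 1) (at_right 0) (Rbar_locally p_infty).

(** [RInt_gen] has a meaningful value only once the integral is known to converge. Completeness
    gives this: the bounded interval integrals have a supremum, and it is the limit. *)
Lemma Gamma_lub (s : R) : 0 < s -> is_lub (interval_integrals (laplace_weight s 1)) (Gamma s).
Proof.
  intros Hs.
  destruct (completeness _ (Gamma_integrals_bounded s Hs)) as [G HG].
  { eexists. exists 1, 1. split; [lra | reflexivity]. }
  replace (Gamma s) with G; [exact HG|]. symmetry. unfold Gamma.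
  apply is_RInt_gen_unique. apply is_RInt_gen_pos_iff_lub.
  - apply continuous_pos_laplace_weight.
  - intros t _. apply Rlt_le, laplace_weight_pos.
  - exact HG.
Qed.

(** On [[1, 2]] the exponential is at least [e^(-2)], and [t^(s-1) >= 1/t >= 1/2] because
    [s - 1 >= -1]. Since the bound is uniform in [s], dividing coefficients by Gamma values
    preserves convergence. *)
Lemma Gamma_lower_bound (s : R) : 0 < s -> exp (- (2)) / 2 <= Gamma s.
Proof.
  intros Hs. apply Rle_trans with (RInt (laplace_weight s 1) 1 2).
  2: { apply (Gamma_lub s Hs). exists 1, 2. split; [lra | reflexivity]. }
  replace (exp (- (2)) / 2) with (RInt (fun _ => exp (- (2)) / 2) 1 2)
    by (rewrite RInt_const; unfold scal; simpl; unfold mult; simpl; ring).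
  apply RInt_le; [lra | apply ex_RInt_const |
    apply ex_RInt_pos; [apply continuous_pos_laplace_weight | lra | lra] |].
  intros t Ht. unfold laplace_weight, Rdiv. apply Rmult_le_compat.
  - apply Rlt_le, exp_pos.
  - lra.
  - apply exp_nondecreasing. lra.
  - apply Rle_trans with (/ t); [apply Rinv_le_contravar; lra|].
    rewrite <- (Rpower_1 t) at 1 by lra. rewrite <- Rpower_Ropp.
    apply Rle_Rpower; lra.
Qed.

(** Multiplication by [x] permutes the compact subintervals of [(0,oo)], so the scaling rule carries
    one supremum to the other. *)
Lemma laplace_weight_integral (s x : R) : 0 < s -> 0 < x ->
  is_lub (interval_integrals (laplace_weight s x)) (Rpower x (- s) * Gamma s).
Proof.
  intros Hs Hx. destruct (Gamma_lub s Hs) as [Hub Hleast].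
  assert (Hp : 0 < Rpower x (- s)) by apply exp_pos.
  split.
  - intros v [a [b [Hab ->]]]. rewrite laplace_weight_scaling by assumption.
    apply Rmult_le_compat_l; [lra|]. apply Hub. exists (x * a), (x * b).
    split; [nra | reflexivity].
  - intros M HM. apply (Rmult_le_reg_l (/ Rpower x (- s))); [now apply Rinv_0_lt_compat|].
    rewrite <- Rmult_assoc, Rinv_l, Rmult_1_l by lra.
    apply Hleast. intros v [a [b [Hab ->]]].
    apply (Rmult_le_reg_l (Rpower x (- s))); [assumption|].
    rewrite <- Rmult_assoc, Rinv_r, Rmult_1_l by lra.
    apply HM. exists (a / x), (b / x).
    assert (Hx' : 0 < / x) by now apply Rinv_0_lt_compat.
    assert (Hab' : 0 < a / x <= b / x) by (unfold Rdiv; nra).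
    split; [exact Hab'|].
    rewrite (laplace_weight_scaling s x (a / x) (b / x)) by assumption.
    f_equal. f_equal; field; lra.
Qed.

(** The factor [t ^ n] is absorbed by raising the parameter of the weight from [lambda] to
    [INR n + lambda]. *)
Lemma laplace_weight_moments (lambda x : R) (n : nat) : 0 < lambda -> 0 < x ->
  is_RInt_gen (fun t => laplace_weight lambda x t * t ^ n)
    (at_right 0) (Rbar_locally p_infty)
    (Rpower x (- (INR n + lambda)) * Gamma (INR n + lambda)).
Proof.
  intros Hl Hx. pose proof (pos_INR n) as Hn.
  apply is_RInt_gen_pos_iff_lub.
  - apply continuous_pos_mult; [apply continuous_pos_laplace_weight|].
    intros t _. apply (ex_derive_continuous (V := R_NormedModule)). now auto_derive.
  - intros t Ht. apply Rmult_le_pos; [apply Rlt_le, laplace_weight_pos | apply pow_le; lra].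
  - refine (interval_integrals_ext (laplace_weight (INR n + lambda) x) _ _ _
      (laplace_weight_integral (INR n + lambda) x _ Hx)); [|lra].
    intros t Ht. unfold laplace_weight. rewrite Rmult_assoc. f_equal.
    rewrite <- (Rpower_pow n t Ht), <- Rpower_plus. f_equal. ring.
Qed.

(** * Transforms of entire series *)

(** Both endpoints are eventually positive, so values of the integrands off [(0,oo)] are never
    seen. *)
Lemma is_RInt_gen_ext_pos (f g : R -> R) (l : R) :
  (forall t, 0 < t -> f t = g t) ->
  is_RInt_gen f (at_right 0) (Rbar_locally p_infty) l ->
  is_RInt_gen g (at_right 0) (Rbar_locally p_infty) l.
Proof.
  intros Hfg. apply is_RInt_gen_ext.
  exists (fun x => 0 < x) (fun y => 0 < y).
  - exists (mkposreal 1 Rlt_0_1). auto.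
  - now exists 0.
  - intros x y Hx Hy t [Ht _]. apply Hfg.
    now apply Rlt_trans with (1 := Rmin_pos x y Hx Hy).
Qed.

Lemma derivatives_in_chain (phi : R -> R) (d : nat -> R -> R) :
  derivatives_in (fun x => 0 <= x) phi d -> derivative_chain d.
Proof.
  intros [_ Hd] k x Hx. apply is_derive_Reals, derivable_pt_lim_D_in.
  intros eps Heps. destruct (Hd k x (Rlt_le _ _ Hx) eps Heps) as [alp [Halp Hlim]].
  (* A radius of at most [x] keeps [y] positive, so the derivative relative to [[0,oo)] is the
     two-sided one. *)
  exists (Rmin alp x). split; [now apply Rmin_pos|].
  intros y [[_ Hneq] Hy]. apply Hlim.
  pose proof (Rmin_l alp x). pose proof (Rmin_r alp x).
  simpl in Hy |- *. unfold Rdist in *. apply Rabs_def2 in Hy as Hy'.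
  split; [split; [lra | exact Hneq] | lra].
Qed.

(** These termwise derivatives serve twice: as the witness in [absolutely_monotonic], endpoint 0
    included, and as a derivative chain for [h]. *)
Definition PSeries_derivatives (a : nat -> R) (k : nat) : R -> R :=
  PSeries (Nat.iter k PS_derive a).

Lemma CV_radius_derivatives (a : nat -> R) (k : nat) :
  CV_radius a = p_infty -> CV_radius (Nat.iter k PS_derive a) = p_infty.
Proof. intros Ha. induction k as [|k IH]; [exact Ha|]. simpl. now rewrite CV_radius_derive. Qed.

Lemma is_derive_PSeries_derivatives (a : nat -> R) (k : nat) (x : R) :
  CV_radius a = p_infty ->
  is_derive (PSeries_derivatives a k) x (PSeries_derivatives a (S k) x).
Proof.
  intros Ha. apply (is_derive_PSeries (Nat.iter k PS_derive a)).
  now rewrite CV_radius_derivatives.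
Qed.

Lemma PSeries_derivatives_pos (a : nat -> R) (k : nat) (x : R) :
  (forall n, 0 <= a n) -> CV_radius a = p_infty -> 0 <= x ->
  0 <= PSeries_derivatives a k x.
Proof.
  intros Ha Hr Hx.
  assert (Hc : forall n, 0 <= Nat.iter k PS_derive a n).
  { induction k as [|k IH]; [exact Ha|]. intros n. simpl. unfold PS_derive.
    apply Rmult_le_pos; [apply pos_INR | apply IH]. }
  assert (Ht : forall n, 0 <= Nat.iter k PS_derive a n * x ^ n).
  { intros n. apply Rmult_le_pos; [apply Hc | now apply pow_le]. }
  apply Rle_trans with (sum_n (fun n => Nat.iter k PS_derive a n * x ^ n) 0).
  - rewrite sum_O. apply Ht.
  - apply series_partial_sum_le; [exact Ht|].
    now apply PSeries_entire, CV_radius_derivatives.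
Qed.

Lemma absolutely_monotonic_PSeries (a : nat -> R) :
  (forall n, 0 <= a n) -> CV_radius a = p_infty -> absolutely_monotonic (PSeries a).
Proof.
  intros Ha Hr. exists (PSeries_derivatives a). split; [split|].
  - reflexivity.
  - intros k x _.
    (* The series is differentiable on the whole line; restricting the limit to the half-line gives
       the one-sided derivative at 0. *)
    apply limit1_imp with (D := D_x no_cond x).
    + intros y [_ Hy]. now split.
    + apply (derivable_pt_lim_D_in (PSeries_derivatives a k) (PSeries_derivatives a (S k)) x),
        is_derive_Reals.
      now apply is_derive_PSeries_derivatives.
  - intros k x Hx. now apply PSeries_derivatives_pos.
Qed.

(** * Passing between the function and its inversion *)

Definition inverted (lambda : R) (f : R -> R) (y : R) : R := Rpower y (- lambda) * f (/ y).

Lemma Rpower_inv (x a : R) : 0 < x -> Rpower (/ x) a = Rpower x (- a).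
Proof. intros Hx. unfold Rpower. rewrite ln_Rinv by assumption. f_equal. ring. Qed.

Lemma inverted_inv (lambda : R) (f : R -> R) (x : R) : 0 < x ->
  inverted lambda f (/ x) = Rpower x lambda * f x.
Proof.
  intros Hx. unfold inverted. now rewrite Rpower_inv, Ropp_involutive, Rinv_inv.
Qed.

Lemma weighted_inverted (lambda : R) (f : R -> R) (k : nat) (x : R) : 0 < x ->
  weighted lambda f k x = Rpower x (INR k - 1) * inverted lambda f (/ x).
Proof.
  intros Hx. rewrite inverted_inv by assumption. unfold weighted.
  rewrite <- Rmult_assoc, <- Rpower_plus. f_equal. f_equal. ring.
Qed.

(** The chain is left arbitrary because two are used: the termwise derivatives of a power series,
    and [Derive_n] of the inverted function itself. *)
Lemma signed_derivative_chain (lambda : R) (f : R -> R) (H : nat -> R -> R) :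
  derivative_chain H -> (forall y, 0 < y -> H 0%nat y = inverted lambda f y) ->
  forall k, n_times_differentiable_pos k (weighted lambda f k) /\
    forall x, 0 < x ->
      signed_derivative lambda f k x = Rpower x (- (INR k + 1)) * H k (/ x).
Proof.
  intros HH H0 k.
  destruct (weighted_inversion_derivatives k H HH) as [Hdiff Hval].
  assert (E : forall x, 0 < x ->
    Rpower x (INR k - 1) * H 0%nat (/ x) = weighted lambda f k x).
  { intros x Hx. rewrite weighted_inverted by assumption. f_equal.
    now apply H0, Rinv_0_lt_compat. }
  split.
  - now apply differentiable_pos_ext with (1 := E).
  - intros x Hx. rewrite <- Hval by assumption. unfold signed_derivative. f_equal.
    symmetry. now apply Derive_n_ext_pos.
Qed.

(** Each [k] yields only [k] derivatives, of a weighted function that itself changes with [k].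
    Solving for [h] gives [h(y) = y^(n-1) w_n(1/y)], where [w_n] is the n-th weighted function, so
    [h] has [n] derivatives for every [n]. *)
Lemma inverted_smooth (lambda : R) (f : R -> R) :
  (forall k, n_times_differentiable_pos k (weighted lambda f k)) ->
  derivative_chain (fun k => Derive_n (inverted lambda f) k).
Proof.
  intros Hw.
  assert (Hn : forall n, n_times_differentiable_pos n (inverted lambda f)).
  { intros n.
    apply differentiable_pos_ext with
      (fun y => Rpower y (INR n - 1) * weighted lambda f n (/ y)).
    - intros y Hy. unfold weighted, inverted. rewrite Rpower_inv by assumption.
      rewrite <- Rmult_assoc, <- Rpower_plus. f_equal. f_equal. ring.
    - apply differentiable_pos_mult; [apply differentiable_pos_Rpower|].
      apply differentiable_pos_comp_inv, Hw. }
  intros k x Hx. apply Derive_correct. now apply (Hn (S k) (S k) x).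
Qed.

(** Multiplying the moments by [x^lambda] leaves powers of [/ x], so for [l = f x] the integral
    identity at [x] becomes the expansion of [h] at [/ x]. *)
Lemma laplace_PSeries (lambda : R) (a : nat -> R) (x l : R) :
  0 < lambda -> 0 < x -> (forall n, 0 <= a n) -> CV_radius a = p_infty ->
  is_RInt_gen (fun t => laplace_weight lambda x t * PSeries a t)
    (at_right 0) (Rbar_locally p_infty) l
  <-> is_series (fun n => a n * Gamma (INR n + lambda) * (/ x) ^ n) (Rpower x lambda * l).
Proof.
  intros Hl Hx Ha Hr.
  rewrite (is_RInt_gen_PSeries (laplace_weight lambda x) a _ l
    (continuous_pos_laplace_weight lambda x)
    (fun t _ => Rlt_le _ _ (laplace_weight_pos lambda x t)) Ha Hr
    (fun n => laplace_weight_moments lambda x n Hl Hx)).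
  assert (Hp : Rpower x lambda * Rpower x (- lambda) = 1).
  { rewrite <- Rpower_plus, Rplus_opp_r. now apply Rpower_O. }
  assert (E : forall n, Rpower x (- (INR n + lambda)) = Rpower x (- lambda) * (/ x) ^ n).
  { intros n. rewrite pow_inv, <- Rpower_pow, <- Rpower_Ropp, <- Rpower_plus by assumption.
    f_equal. ring. }
  split; intros H.
  - apply (is_series_scal (Rpower x lambda)) in H.
    refine (is_series_ext _ _ _ _ H). intros n. unfold scal; simpl; unfold mult; simpl.
    rewrite E. transitivity ((Rpower x lambda * Rpower x (- lambda))
      * (a n * Gamma (INR n + lambda) * (/ x) ^ n)); [ring|]. rewrite Hp. ring.
  - apply (is_series_scal (Rpower x (- lambda))) in H.
    replace l with (scal (Rpower x (- lambda)) (Rpower x lambda * l)).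
    + refine (is_series_ext _ _ _ _ H). intros n. unfold scal; simpl; unfold mult; simpl.
      rewrite E. ring.
    + unfold scal; simpl; unfold mult; simpl.
      transitivity ((Rpower x lambda * Rpower x (- lambda)) * l); [ring|]. rewrite Hp. ring.
Qed.

Lemma laplace_absolutely_monotonic_inverted (lambda : R) (f phi : R -> R) :
  0 < lambda -> absolutely_monotonic phi ->
  (forall x, 0 < x -> is_RInt_gen (fun t => laplace_weight lambda x t * phi t)
     (at_right 0) (Rbar_locally p_infty) (f x)) ->
  exists b, (forall n, 0 <= b n) /\
    forall y, 0 < y -> is_series (fun n => b n * y ^ n) (inverted lambda f y).
Proof.
  intros Hl [d [Hd Hpos]] Hf.
  destruct (chain_power_series d (derivatives_in_chain phi d Hd)) as [a [Ha Hs]].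
  { intros k x Hx. apply Hpos. lra. }
  assert (Hr : CV_radius a = p_infty).
  { apply CV_radius_p_infty. intros t Ht. eexists. now apply Hs. }
  exists (fun n => a n * Gamma (INR n + lambda)). split.
  - intros n. apply Rmult_le_pos; [apply Ha|].
    pose proof (pos_INR n). pose proof (Gamma_lower_bound (INR n + lambda) ltac:(lra)).
    pose proof (exp_pos (- (2))). lra.
  - intros y Hy. pose proof (Rinv_0_lt_compat y Hy) as Hy'.
    replace y with (/ / y) by apply Rinv_inv. rewrite inverted_inv by assumption.
    apply laplace_PSeries; auto.
    (* For [t > 0] the function [phi] agrees with the series from Bernstein's theorem, and only
       these values enter the integral. *)
    refine (is_RInt_gen_ext_pos _ _ _ _ (Hf (/ y) Hy')).
    intros t Ht. f_equal. rewrite <- (proj1 Hd t) by lra.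
    rewrite <- (is_series_unique _ _ (Hs t Ht)).
    now apply is_series_unique, PSeries_entire.
Qed.

Lemma inverted_laplace_absolutely_monotonic (lambda : R) (f : R -> R) (b : nat -> R) :
  0 < lambda -> (forall n, 0 <= b n) ->
  (forall y, 0 < y -> is_series (fun n => b n * y ^ n) (inverted lambda f y)) ->
  exists phi, absolutely_monotonic phi /\
    forall x, 0 < x -> is_RInt_gen (fun t => laplace_weight lambda x t * phi t)
     (at_right 0) (Rbar_locally p_infty) (f x).
Proof.
  intros Hl Hb Hs.
  set (c := exp (- (2)) / 2).
  assert (Hc : 0 < c) by (unfold c; pose proof (exp_pos (- (2))); lra).
  assert (HG : forall n, c <= Gamma (INR n + lambda)).
  { intros n. apply Gamma_lower_bound. pose proof (pos_INR n). lra. }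
  set (a := fun n => b n / Gamma (INR n + lambda)).
  assert (Ha : forall n, 0 <= a n).
  { intros n. apply Rmult_le_pos; [apply Hb|].
    apply Rlt_le, Rinv_0_lt_compat. specialize (HG n). lra. }
  (* Comparison with the series for [h]: as the Gamma values stay above [c], [a n * t ^ n] is at
     most [/ c * (b n * t ^ n)]. *)
  assert (Hr : CV_radius a = p_infty).
  { apply CV_radius_p_infty. intros t Ht.
    apply (ex_series_le (K := R_AbsRing) (V := R_CompleteNormedModule) _
             (fun n => / c * (b n * t ^ n))).
    - intros n. assert (Htn : 0 <= t ^ n) by (apply pow_le; lra).
      change (Rabs (a n * t ^ n) <= / c * (b n * t ^ n)).
      rewrite Rabs_pos_eq by now apply Rmult_le_pos.
      rewrite <- Rmult_assoc. apply Rmult_le_compat_r; [assumption|].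
      unfold a, Rdiv. rewrite Rmult_comm. apply Rmult_le_compat_r; [apply Hb|].
      apply Rinv_le_contravar; auto.
    - apply (ex_series_scal (K := R_AbsRing) (V := R_NormedModule) (/ c)
               (fun n => b n * t ^ n)). eexists. now apply Hs. }
  exists (PSeries a). split; [now apply absolutely_monotonic_PSeries|].
  intros x Hx. apply laplace_PSeries; auto.
  rewrite <- inverted_inv by assumption.
  refine (is_series_ext _ _ _ _ (Hs (/ x) (Rinv_0_lt_compat x Hx))).
  intros n. specialize (HG n). unfold a, Rdiv.
  rewrite (Rmult_assoc (b n)), Rinv_l, Rmult_1_r by lra. reflexivity.
Qed.

Theorem theorem1p5 (lambda : R) (hlambda : 0 < lambda) (f : R -> R) :
  let i :=
    exists phi : R -> R,
      absolutely_monotonic phi /\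
      (forall x, 0 < x ->
         is_RInt_gen (fun t => exp (- (x * t)) * Rpower t (lambda - 1) * phi t)
           (at_right 0) (Rbar_locally p_infty) (f x)) in
  let ii :=
    forall k : nat,
      n_times_differentiable_pos k (weighted lambda f k) /\
      completely_monotonic (signed_derivative lambda f k) in
  let iii :=
    forall k : nat,
      n_times_differentiable_pos k (weighted lambda f k) /\
      (forall x, 0 < x -> 0 <= signed_derivative lambda f k x) in
  (i <-> ii) /\ (ii <-> iii).
Proof.
  intros i ii iii.
  assert (H12 : i -> ii).
  { intros [phi [Hphi Hf]] k.
    destruct (laplace_absolutely_monotonic_inverted lambda f phi hlambda Hphi Hf)
      as [b [Hb Hs]].
    assert (Hr : CV_radius b = p_infty).
    { apply CV_radius_p_infty. intros t Ht. eexists. now apply Hs. }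
    (* The series for [h] is entire with non-negative coefficients, so its termwise derivatives form
       a chain that is non-negative on [(0,oo)]. *)
    assert (HH : derivative_chain (PSeries_derivatives b)).
    { intros j x _. now apply is_derive_PSeries_derivatives. }
    destruct (signed_derivative_chain lambda f _ HH) with (k := k) as [Hdiff Hval].
    { intros y Hy. rewrite <- (is_series_unique _ _ (Hs y Hy)). symmetry.
      now apply is_series_unique, PSeries_entire. }
    split; [exact Hdiff|].
    apply completely_monotonic_ext with
      (fun x => Rpower x (- (INR k + 1)) * PSeries_derivatives b k (/ x)).
    - intros x Hx. now rewrite Hval.
    - apply completely_monotonic_inversion; [exact HH | |].
      + intros j x Hx. apply PSeries_derivatives_pos; auto. lra.
      + pose proof (pos_INR k). lra. }
  assert (H23 : ii -> iii).
  { intros H k. destruct (H k) as [Hdiff [_ Hcm]]. split; [exact Hdiff|].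
    intros x Hx. specialize (Hcm 0%nat x Hx). simpl in Hcm. lra. }
  assert (H31 : iii -> i).
  { intros H.
    assert (HH : derivative_chain (fun k => Derive_n (inverted lambda f) k)).
    { apply inverted_smooth. intros k. apply H. }
    destruct (chain_power_series _ HH) as [b [Hb Hs]].
    (* At [x = / y] the signed derivative is a positive power times [h^(k)(y)]; cancelling that
       power gives the sign. *)
    - intros k y Hy. pose proof (Rinv_0_lt_compat y Hy) as Hy'.
      destruct (signed_derivative_chain lambda f _ HH (fun y _ => eq_refl) k) as [_ Hval].
      pose proof (proj2 (H k) (/ y) Hy') as Hk. rewrite Hval, Rinv_inv in Hk by assumption.
      apply (Rmult_le_reg_l (Rpower (/ y) (- (INR k + 1)))); [apply exp_pos|].
      now rewrite Rmult_0_r.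
    - exact (inverted_laplace_absolutely_monotonic lambda f b hlambda Hb Hs). }
  tauto.
Qed.
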